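(* Let $\Lambda=\{0=\alpha_0<\alpha_1<\dots<\alpha_m=1\}$ be a partition of $[0,1]$. The mapping $\Phi_{param}:\operatorname{FFN}_\Lambda(\mathbb{R})\to\operatorname{seq}(\mathbb{R})$ defined, for each $A\in\operatorname{FFN}_\Lambda(\mathbb{R})$ with $\alpha$-cuts $A_{\alpha_i}=[\underline{A}_{\alpha_i},\overline{A}_{\alpha_i}]$, $i\in\{1,\dots,m\}$, by $$\Phi_{param}(A)=\{\underline{A}_{\alpha_1},\overline{A}_{\alpha_1},\underline{A}_{\alpha_2},\overline{A}_{\alpha_2},\dots,\underline{A}_{\alpha_m},\overline{A}_{\alpha_m},0,0,\dots\}$$ is injective. Consequently, the sequential order $\le_{\Phi_{param}}$ is a total order on $\operatorname{FFN}_\Lambda(\mathbb{R})$.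
   Context: A fuzzy set on $\mathbb{R}$ is a map $A:\mathbb{R}\to[0,1]$; for $\alpha\in(0,1]$, $A_\alpha=\{x:A(x)\ge\alpha\}$, and $A_0$ is the closure of the support $\bigcup_{\alpha\in(0,1]}A_\alpha$. $A$ is a fuzzy number if $A_1\ne\emptyset$, $A_0$ is bounded, and $A_\alpha=[\underline{A}_\alpha,\overline{A}_\alpha]$ is a closed interval for each $\alpha\in(0,1]$. A fuzzy number is finite if its image $A(\mathbb{R})$ is a finite set. For a partition $\Lambda=\{0=\alpha_0<\alpha_1<\dots<\alpha_m=1\}$, $\operatorname{FFN}_\Lambda(\mathbb{R})$ is the family of all finite fuzzy numbers associated to $\Lambda$, i.e. those fuzzy numbers $A$ with $A_\alpha=A_\beta$ for all $\alpha,\beta\in(\alpha_{i-1},\alpha_i]$ and all $i\in\{1,\dots,m\}$. $\operatorname{seq}(\mathbb{R})=\mathbb{R}^{\mathbb{N}_0}$ with $\mathbb{N}_0=\{0,1,2,\dots\}$, and $\mathfrak a\sqsubseteq\mathfrak b$ means that either $\mathfrak a=\mathfrak b$, or there is $n_0\in\mathbb{N}_0$ with $a_n=b_n$ for all $n<n_0$ and $a_{n_0}<b_{n_0}$. For $\Phi:X\to\operatorname{seq}(\mathbb{R})$, $x\le_\Phi y\iff\Phi(x)\sqsubseteq\Phi(y)$. *)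

(* Defs.v *)
From HB Require Import structures.
From mathcomp Require Import all_boot all_order all_algebra.
From mathcomp Require Import all_classical all_reals all_analysis.

Set Implicit Arguments.
Unset Strict Implicit.
Unset Printing Implicit Defensive.

Import Order.TTheory GRing.Theory Num.Theory.
Import numFieldNormedType.Exports.

Local Open Scope classical_set_scope.
Local Open Scope ring_scope.

Section FuzzyNumbers.
Variable R : realType.
Implicit Types (A : R -> R) (a b : R).

Definition fuzzy_set A : Prop := forall x, 0 <= A x <= 1.

(* The cut at level a, meaningful for 0 < a <= 1 only; the cut at level 0 is
   [cut0]. *)
Definition cut A a : set R := [set x | a <= A x].

Definition fuzzy_support A : set R := \bigcup_(a in [set` `]0, 1]]) cut A a.

Definition cut0 A : set R := closure (fuzzy_support A).

Definition fuzzy_number A : Prop :=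
  [/\ fuzzy_set A,
      cut A 1 !=set0,
      bounded_set (cut0 A) &
      forall a, a \in `]0, 1] ->
        exists l u : R, l <= u /\ cut A a = [set` `[l, u]]].

Definition finite_fuzzy_number A : Prop :=
  fuzzy_number A /\ finite_set (range A).

(* The endpoints of a cut which is a closed interval, see [cutE]. *)
Definition lower A a : R := inf (cut A a).
Definition upper A a : R := sup (cut A a).

Lemma cutE A a : fuzzy_number A -> a \in `]0, 1] ->
  cut A a = [set` `[lower A a, upper A a]].
Proof.
move=> [_ _ _ /[apply]] [l [u [lu E]]].
by rewrite /lower /upper E inf_itv ?sup_itv.
Qed.

Section Partition.
Variables (m : nat) (alpha : 'I_m.+1 -> R).

Definition unit_partition : Prop :=
  [/\ alpha ord0 = 0, alpha ord_max = 1 &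
      forall i j : 'I_m.+1, (i < j)%N -> alpha i < alpha j].

(* The index i : 'I_m stands for i + 1 in {1, ..., m}: the two points below
   are the consecutive points of indices i and i + 1. *)
Definition left_pt (i : 'I_m) : R := alpha (widen_ord (leqnSn m) i).
Definition right_pt (i : 'I_m) : R := alpha (lift ord0 i).

Definition FFN : set (R -> R) := [set A | finite_fuzzy_number A /\
  forall (i : 'I_m) a b,
    a \in `]left_pt i, right_pt i] -> b \in `]left_pt i, right_pt i] ->
    cut A a = cut A b].

(* [nth 0] pads the finite list with zeros. *)
Definition Phi_param (A : FFN) : nat -> R := fun n =>
  nth 0 (flatten [seq [:: lower (val A) (right_pt i); upper (val A) (right_pt i)]
                 | i <- enum 'I_m]) n.

End Partition.

Definition seq_le (s t : nat -> R) : Prop :=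
  s = t \/ exists n0 : nat,
    (forall n : nat, (n < n0)%N -> s n = t n) /\ s n0 < t n0.

Definition sequential_order (X : Type) (Phi : X -> nat -> R) : rel X :=
  fun x y => `[< seq_le (Phi x) (Phi y) >].

End FuzzyNumbers.

Definition total_order (X : Type) (le : rel X) : Prop :=
  [/\ reflexive le, antisymmetric le, transitive le & total le].

(* Finiteness of the image follows from the condition on the cuts, so that
   requiring it in [FFN] is harmless. *)
Lemma FFN_E (R : realType) (m : nat) (alpha : 'I_m.+1 -> R) (A : R -> R) :
  unit_partition alpha -> fuzzy_number A ->
  (forall (i : 'I_m) (a b : R),
    a \in `]left_pt alpha i, right_pt alpha i] ->
    b \in `]left_pt alpha i, right_pt alpha i] -> cut A a = cut A b) ->
  FFN alpha A.
Proof.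
move=> [a0 a1 ainc] Afn Acst; split=> //; split=> //.
apply: (@sub_finite_set _ _ (range alpha)); last exact/finite_image/finite_finset.
move=> _ [x _ <-] /=; have [Afs _ _ _] := Afn.
have /andP[A0 A1] := Afs x.
have [i Ai imin] : exists2 i : 'I_m.+1, A x <= alpha i &
    forall j : 'I_m.+1, (j < i)%N -> alpha j < A x.
  have P1 : A x <= alpha ord_max by rewrite a1.
  case: (@arg_minnP _ ord_max (fun i => A x <= alpha i) (@nat_of_ord _) P1).
  move=> i Pi imin; exists i => // j ji; rewrite ltNge; apply/negP => /imin.
  by rewrite leqNgt ji.
exists i => //; case: (unliftP ord0 i) => [j|] ij; last first.
  by apply/eqP; rewrite eq_le Ai ij a0 A0.
have jl : left_pt alpha j < A x by apply: imin; rewrite ij /= /bump /= add1n.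
have jr : A x <= right_pt alpha j by rewrite /right_pt -ij.
have : cut A (A x) x by rewrite /cut /=.
rewrite (Acst j (A x) (right_pt alpha j)) ?in_itv /= ?jl ?jr ?lexx //; last first.
  by rewrite (lt_le_trans jl jr).
by rewrite /cut /right_pt /= -ij => iA; apply/eqP; rewrite eq_le Ai iA.
Qed.

(* Main.v *)
(** Each level a in ]0, 1] lies in some block ]alpha_(i-1), alpha_i], on which the
    cuts of A are constant; so the endpoints recorded by [Phi_param A] determine
    every cut of A, and A x is the largest a with x in the a-cut (or 0). The
    lexicographic order on real sequences is total because two distinct sequences
    have a least index at which they differ; it pulls back along an injection. *)

Require Import Defs.
From HB Require Import structures.
From mathcomp Require Import all_boot all_order all_algebra.
From mathcomp Require Import all_classical all_reals all_analysis.

Set Implicit Arguments.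
Unset Strict Implicit.
Unset Printing Implicit Defensive.

Import Order.TTheory GRing.Theory Num.Theory.

Local Open Scope classical_set_scope.
Local Open Scope ring_scope.

Section LexicographicOrder.
Variable R : realType.
Implicit Types s t u : nat -> R.

Lemma seq_le_trans t s u : seq_le s t -> seq_le t u -> seq_le s u.
Proof.
move=> [->//|[p [st stp]]] [<-|[q [tu tuq]]]; first by right; exists p.
(* At the smaller of the two indices one comparison is strict, and the other is an equality, or
   strict too if the indices coincide. *)
right; exists (minn p q); split=> [n|].
  by rewrite leq_min => /andP[np nq]; rewrite st ?tu.
case: (ltngtP p q) => [pq|qp|pq].
- by rewrite -tu.
- by rewrite st.
- by apply: lt_trans stp _; rewrite pq.
Qed.

Lemma seq_le_anti s t : seq_le s t -> seq_le t s -> s = t.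
Proof.
move=> [//|[p [st stp]]] [//|[q [ts tsq]]].
case: (ltngtP p q) => [pq|qp|pq].
- by move: stp; rewrite ts ?ltxx.
- by move: tsq; rewrite st ?ltxx.
- by move: stp; rewrite pq ltNge (ltW tsq).
Qed.

Lemma seq_le_total s t : seq_le s t \/ seq_le t s.
Proof.
have [st|/existsNP[n /eqP stn]] := pselect (forall n, s n = t n).
  by left; left; apply/funext.
have exP : exists n, s n != t n by exists n.
case: (ex_minnP exP) => p stp pmin.
have eq_lt k : (k < p)%N -> s k = t k.
  by move=> kp; apply/eqP; apply: contraLR kp => /pmin; rewrite -leqNgt.
move: stp; rewrite neq_lt => /orP[stp|tsp]; [left|right]; right; exists p.
  by split.
by split=> // k /eq_lt.
Qed.

Lemma sequential_order_total (X : Type) (Phi : X -> nat -> R) :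
  injective Phi -> total_order (sequential_order Phi).
Proof.
move=> Phi_inj; split.
- by move=> x; apply/asboolP; left.
- move=> x y /andP[/asboolP xy /asboolP yx].
  (* Injectivity enters here: equal images must come from equal points. *)
  exact: Phi_inj (seq_le_anti xy yx).
- move=> y x z /asboolP xy /asboolP yz; apply/asboolP.
  exact: seq_le_trans xy yz.
- by move=> x y; apply/orP; case: (seq_le_total (Phi x) (Phi y));
    [left|right]; apply/asboolP.
Qed.

End LexicographicOrder.

(** Every block has length two, so the flattened lists stay aligned and can be peeled off two
    entries at a time. *)
Lemma flatten_pairs_inj (I : eqType) (T : Type) (s : seq I)
    (f g f' g' : I -> T) :
  flatten [seq [:: f i; g i] | i <- s] = flatten [seq [:: f' i; g' i] | i <- s] ->
  {in s, forall i, f i = f' i /\ g i = g' i}.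
Proof.
elim: s => [//|j s IHs] /= [fj gj /IHs eqs] i.
by rewrite inE => /predU1P[->|/eqs].
Qed.

(** Equal lengths rule out confusion between a genuine entry 0 and the zero padding of
    [Phi_param]. *)
Lemma size_flatten_pairs (I T : Type) (s : seq I) (f g : I -> T) :
  size (flatten [seq [:: f i; g i] | i <- s]) = (size s).*2.
Proof. by elim: s => //= i s ->. Qed.

(** If [A x] is nonzero it is itself an admissible level, and [x] lies in the cut of [A] at that
    level, hence in that of [B]. *)
Lemma fuzzy_set_cut_le (R : realType) (A B : R -> R) :
  fuzzy_set A -> fuzzy_set B ->
  (forall a : R, a \in `]0, 1] -> Defs.cut A a = Defs.cut B a) ->
  forall x, A x <= B x.
Proof.
move=> A01 B01 AB x; have /andP[A0 A1] := A01 x.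
have [->|nA0] := eqVneq (A x) 0; first by have /andP[] := B01 x.
have /AB cutAB : A x \in `]0, 1] by rewrite in_itv /= lt0r nA0 A0.
suff : Defs.cut B (A x) x by [].
by rewrite -cutAB; exact: lexx.
Qed.

Lemma fuzzy_set_cut_inj (R : realType) (A B : R -> R) :
  fuzzy_set A -> fuzzy_set B ->
  (forall a : R, a \in `]0, 1] -> Defs.cut A a = Defs.cut B a) -> A = B.
Proof.
move=> A01 B01 AB; apply/funext => x; apply/eqP.
by rewrite eq_le !fuzzy_set_cut_le // => a /AB.
Qed.

Section Partition.
Variables (R : realType) (m : nat) (alpha : 'I_m.+1 -> R).
Hypothesis alphaP : unit_partition alpha.

Lemma unit_partition_cover a : a \in `]0, 1] ->
  exists i : 'I_m, a \in `]left_pt alpha i, right_pt alpha i].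
Proof.
have [a0 a1 _] := alphaP; rewrite in_itv /= => /andP[a_gt0 a_le1].
have P1 : a <= alpha ord_max by rewrite a1.
case: (@arg_minnP _ ord_max (fun i => a <= alpha i) (@nat_of_ord _) P1).
(* The least index [i] with [a <= alpha i] is not 0, because [alpha ord0 = 0 < a]; so [i] is the
   successor of some [j], and minimality gives [left_pt alpha j < a]. *)
move=> i ai imin; case: (unliftP ord0 i) => [j|] ij; last first.
  by move: ai; rewrite ij a0 leNgt a_gt0.
exists j; rewrite in_itv /= /right_pt -ij ai andbT ltNge.
by apply/negP => /imin; rewrite ij /= /bump /= add1n ltnn.
Qed.

Lemma right_pt_itv (i : 'I_m) : right_pt alpha i \in `]0, 1].
Proof.
have [a0 a1 ainc] := alphaP; rewrite in_itv /= -[X in X < _]a0 /right_pt.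
rewrite ainc //= -a1; have [->//|neq] := eqVneq (lift ord0 i) ord_max.
by apply/ltW/ainc; rewrite ltn_neqAle neq -ltnS ltn_ord.
Qed.

Lemma right_pt_block (i : 'I_m) :
  right_pt alpha i \in `]left_pt alpha i, right_pt alpha i].
Proof.
have [_ _ ainc] := alphaP.
by rewrite in_itv /= lexx andbT; apply: ainc; rewrite /= /bump add1n.
Qed.

Lemma Phi_param_inj : injective (@Phi_param R m alpha).
Proof.
move=> A B PhiAB.
have [[Afn _] Acst] := set_valP A; have [[Bfn _] Bcst] := set_valP B.
have /flatten_pairs_inj eqAB :
    flatten [seq [:: lower (val A) (right_pt alpha i);
                     upper (val A) (right_pt alpha i)] | i <- enum 'I_m] =
    flatten [seq [:: lower (val B) (right_pt alpha i);
                     upper (val B) (right_pt alpha i)] | i <- enum 'I_m].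
  apply: (@eq_from_nth _ 0); first by rewrite !size_flatten_pairs.
  (* The [n]-th entries are the values of [Phi_param] at [n] by definition. *)
  by move=> n _; exact: (congr1 (@^~ n) PhiAB).
apply: val_inj; apply: fuzzy_set_cut_inj; [by case: Afn|by case: Bfn|].
move=> a /unit_partition_cover[i ai].
(* The level [a] is moved to the right end of its block, where [Phi_param] records the endpoints. *)
rewrite (Acst i _ _ ai (right_pt_block i)) (Bcst i _ _ ai (right_pt_block i)).
have [lowAB upAB] := eqAB i (mem_enum _ _).
by rewrite !cutE ?right_pt_itv // lowAB upAB.
Qed.

End Partition.

Theorem proposition6p6 (R : realType) (m : nat) (alpha : 'I_m.+1 -> R)
    (halpha : unit_partition alpha) :
  injective (@Phi_param R m alpha) /\
  total_order (sequential_order (@Phi_param R m alpha)).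
Proof.
split; first exact: Phi_param_inj.
exact/sequential_order_total/Phi_param_inj.
Qed.
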